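(* Let $X$ be a Banach space over $\mathbb{F}$ ($\mathbb{F}=\mathbb{R}$ or $\mathbb{C}$), let $\mathcal{L}$ be a subspace lattice on $X$ such that $\vee\{L:L\in\mathcal{P}_{\mathcal{L}}\}=X$, and let $\delta:\mathrm{Alg}\mathcal{L}\to B(X)$ be a linear mapping. Then $\delta$ is Jordan derivable at zero point if and only if $\delta$ is a generalized derivation and $\delta(I)\in(\mathrm{Alg}\mathcal{L})'$. In particular, if $\delta(I)=0$, then $\delta$ is Jordan derivable at zero point if and only if $\delta$ is a derivation.
   Context: $B(X)$ is the algebra of bounded linear operators on $X$. A subspace of $X$ means a norm-closed linear manifold. A subspace lattice on $X$ is a collection $\mathcal{L}$ of subspaces of $X$ containing $(0)$ and $X$ such that for every family $\{M_r\}$ in $\mathcal{L}$ the intersection $\wedge M_r$ and the closed linear span $\vee M_r$ belong to $\mathcal{L}$ (the closed span of an empty family is $(0)$). $\mathrm{Alg}\mathcal{L}$ is the algebra of operators in $B(X)$ that leave every member of $\mathcal{L}$ invariant, and $(\mathrm{Alg}\mathcal{L})'$ is its commutant in $B(X)$. For $E\in\mathcal{L}$, $E_-=\vee\{F\in\mathcal{L}:F\nsupseteq E\}$, and $\mathcal{P}_{\mathcal{L}}=\{L\in\mathcal{L}:L_-\nsupseteq L\}$. A linear mapping $\delta:\mathrm{Alg}\mathcal{L}\to B(X)$ is Jordan derivable at zero point if $\delta(AB+BA)=\delta(A)B+A\delta(B)+\delta(B)A+B\delta(A)$ for all $A,B\in\mathrm{Alg}\mathcal{L}$ with $AB+BA=0$.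 It is a derivation if $\delta(AB)=\delta(A)B+A\delta(B)$ for all $A,B$, and a generalized derivation if $\delta(AB)=\delta(A)B+A\delta(B)-A\delta(I)B$ for all $A,B$. *)

(* Defs.v *)
From HB Require Import structures.
From mathcomp Require Import all_boot all_order all_algebra.
From mathcomp Require Import complex.
From mathcomp Require Import boolp classical_sets functions reals.
From mathcomp Require Import topology normedtype.

Set Implicit Arguments.
Unset Strict Implicit.
Unset Printing Implicit Defensive.

Import Order.TTheory GRing.Theory Num.Theory.
Import numFieldNormedType.Exports.

Local Open Scope classical_set_scope.
Local Open Scope ring_scope.

(* [scalar_field R K] says that K is the field R of real numbers or the field
   R[i] of complex numbers.  Over R[i] the norm of a normed module takes its
   values in R[i]; these are nonnegative, hence real. *)
Variant scalar_field (R : realType) : numFieldType -> Prop :=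
  | RealScalars : scalar_field R R
  | ComplexScalars : scalar_field R R[i].

Section BoundedOperators.
Context (K : numFieldType) (X : normedModType K).

Definition bounded_linear : {pred X -> X} :=
  fun T => `[< linear T /\ exists M : K, forall x, `|T x| <= M * `|x| >].

Record bounded_operator := BoundedOperator {
  bounded_operator_fun :> X -> X;
  _ : bounded_operator_fun \in bounded_linear }.

HB.instance Definition _ := [isSub for bounded_operator_fun].
HB.instance Definition _ := [Choice of bounded_operator by <:].

Lemma bounded_linear_submod_closed : submod_closed bounded_linear.
Proof.
split.
  apply/asboolP; split=> [a x y|].
    by rewrite -[LHS]/(0 : X) -[RHS]/(a *: (0 : X) + 0) scaler0 addr0.
  by exists 0 => x; rewrite -[X in `|X| <= _]/(0 : X) normr0 mul0r.
move=> a S T /asboolP[linS [M SM]] /asboolP[linT [N TN]]; apply/asboolP.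
have STE x : (a *: S + T) x = a *: S x + T x by [].
split=> [b x y|].
  rewrite !STE linS linT !scalerDr !scalerA (mulrC a) -!addrA; congr (_ + _).
  by rewrite !addrA (addrC (a *: S y)).
exists (`|a| * M + N) => x; rewrite STE (le_trans (ler_normD _ _))//.
by rewrite mulrDl lerD// normrZ -mulrA ler_wpM2l.
Qed.

(* The vector space structure is that of pointwise addition and scaling. *)
HB.instance Definition _ := GRing.SubChoice_isSubLmodule.Build K (X -> X)
  bounded_linear bounded_operator
  (GRing.submod_closed_semi bounded_linear_submod_closed).

Implicit Types S T U : bounded_operator.

Lemma bounded_operator_linear T : linear T.
Proof. by case: T => T /= /asboolP[]. Qed.

Lemma bounded_operator_bounded T : exists M : K, forall x, `|T x| <= M * `|x|.
Proof. by case: T => T /= /asboolP[]. Qed.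

Lemma bounded_operatorP S T : S =1 T -> S = T.
Proof. by move=> ST; apply/val_inj/funext. Qed.

Lemma id_bounded_linear : (@id X) \in bounded_linear.
Proof. by apply/asboolP; split=> //; exists 1 => x; rewrite mul1r. Qed.

Lemma comp_bounded_linear S T : S \o T \in bounded_linear.
Proof.
apply/asboolP; split=> [a x y|] /=; first by rewrite !bounded_operator_linear.
have [M SM] := bounded_operator_bounded S.
have [N TN] := bounded_operator_bounded T.
exists (`|M| * N) => x; rewrite (le_trans (SM _))//.
have [->|Tx0] := eqVneq (T x) 0.
  by rewrite normr0 mulr0 -mulrA mulr_ge0// (le_trans _ (TN x)).
have M0 : 0 <= M by rewrite -(@pmulr_lge0 _ `|T x|) ?normr_gt0// (le_trans _ (SM _)).
by rewrite (ger0_norm M0) -mulrA ler_wpM2l.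
Qed.

Definition id_operator := BoundedOperator id_bounded_linear.
Definition comp_operator S T := BoundedOperator (comp_bounded_linear S T).

Let compA : associative comp_operator.
Proof. by move=> S T U; apply: bounded_operatorP. Qed.

Let comp1o : left_id id_operator comp_operator.
Proof. by move=> S; apply: bounded_operatorP. Qed.

Let compo1 : right_id id_operator comp_operator.
Proof. by move=> S; apply: bounded_operatorP. Qed.

Let compDl : left_distributive comp_operator +%R.
Proof. by move=> S T U; apply: bounded_operatorP. Qed.

Let compDr : right_distributive comp_operator +%R.
Proof.
move=> S T U; apply: bounded_operatorP => x.
have /= := bounded_operator_linear S 1 (T x) (U x).
by rewrite !scale1r.
Qed.

(* X may be the zero space, in which case 1 = 0. *)
HB.instance Definition _ := GRing.Zmodule_isPzRing.Build bounded_operator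
  compA comp1o compo1 compDl compDr.

End BoundedOperators.

Notation "''B' ( X )" := (bounded_operator X)
  (at level 8, format "''B' ( X )") : type_scope.

Section SubspaceLattices.
Context (K : numFieldType) (X : normedModType K).

Definition linear_manifold (M : set X) := submod_closed (mem M).

Definition subspace (M : set X) := linear_manifold M /\ closed M.

Definition linear_span (A : set X) : set X := smallest linear_manifold A.

Definition closed_span (A : set X) : set X := closure (linear_span A).

Definition meet (F : set (set X)) : set X := \bigcap_(M in F) M.

Definition join (F : set (set X)) : set X := closed_span (\bigcup_(M in F) M).

Record subspace_lattice := SubspaceLattice {
  members : set (set X);
  lattice_subspace : forall M, members M -> subspace M;
  lattice_bot : members [set 0];
  lattice_top : members setT;
  lattice_meet : forall F, F `<=` members -> members (meet F);
  lattice_join : forall F, F `<=` members -> members (join F) }.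

(* Usually written E_- *)
Definition lower (L : subspace_lattice) (E : set X) : set X :=
  join [set F | members L F /\ ~ E `<=` F].

Definition PL (L : subspace_lattice) : set (set X) :=
  [set E | members L E /\ ~ E `<=` lower L E].

End SubspaceLattices.

Section Alg.
Context (K : numFieldType) (X : normedModType K) (L : subspace_lattice X).

Definition leaves_invariant : {pred 'B(X)} :=
  fun T => `[< forall M, members L M -> forall x, M x -> M (T x) >].

Record Alg := MkAlg { alg_val :> 'B(X); _ : alg_val \in leaves_invariant }.

HB.instance Definition _ := [isSub for alg_val].
HB.instance Definition _ := [Choice of Alg by <:].

Lemma leaves_invariant_submod_closed : submod_closed leaves_invariant.
Proof.
split; first apply/asboolP => M /lattice_subspace[[/set_mem M0 _] _] x _ //.
move=> a S T /asboolP LS /asboolP LT; apply/asboolP => M LM x Mx.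
have [[_ linM] _] := lattice_subspace LM.
by apply/set_mem/linM; apply/mem_set; [exact: LS | exact: LT].
Qed.

Lemma leaves_invariant_subring_closed : subring_closed leaves_invariant.
Proof.
have [_ BL] := GRing.submod_closedB leaves_invariant_submod_closed.
split=> //; first by apply/asboolP.
move=> S T /asboolP LS /asboolP LT; apply/asboolP => M LM x Mx.
by apply: (LS M LM); apply: LT.
Qed.

HB.instance Definition _ := GRing.SubChoice_isSubPzRing.Build 'B(X)
  leaves_invariant Alg leaves_invariant_subring_closed.
HB.instance Definition _ := GRing.SubZmodule_isSubLmodule.Build K 'B(X)
  leaves_invariant Alg
  (GRing.submod_closed_semi leaves_invariant_submod_closed).

Definition Alg_commutant : set 'B(X) :=
  [set T : 'B(X) | forall A : Alg, T * (A : 'B(X)) = (A : 'B(X)) * T].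

(* In the following identities the products on the right-hand sides are taken
   in B(X), and those to which delta is applied are taken in Alg L. *)
Implicit Types (delta : Alg -> 'B(X)).

Definition Jordan_derivable_at_zero delta := forall A B : Alg,
  A * B + B * A = 0 ->
  delta (A * B + B * A) =
    delta A * (B : 'B(X)) + (A : 'B(X)) * delta B
    + delta B * (A : 'B(X)) + (B : 'B(X)) * delta A.

Definition derivation delta := forall A B : Alg,
  delta (A * B) = delta A * (B : 'B(X)) + (A : 'B(X)) * delta B.

Definition generalized_derivation delta := forall A B : Alg,
  delta (A * B) = delta A * (B : 'B(X)) + (A : 'B(X)) * delta B
                  - (A : 'B(X)) * delta 1 * (B : 'B(X)).

End Alg.

(* Main.v *)
(* Put c = delta(I).  Testing the hypothesis on an idempotent P and on I - P
   shows that c commutes with P.  For E in P_L choose z in E and, by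
   Hahn-Banach, a bounded functional g that vanishes on E_- with g(z) = 1; the
   rank one operators x (x) g with x in E lie in Alg L, and those with
   g(x) = 1 are idempotent, so c acts on E as a scalar.  As the members of P_L
   span X, c commutes with Alg L and D = delta - c is Jordan derivable at zero
   with D(I) = 0.

   Testing D on pairs made of Peirce pieces of A and of polynomials in an
   idempotent P gives the Jordan derivation rule for (A, P).  For P = z (x) g,
   subtract an inner derivation to get D(P) = 0 and set T x = D(x (x) g) z.  The
   operators N of square zero satisfy D(N) N + N D(N) = 0, and since those used
   have rank one, this excludes an antiderivation part of D and yields
   D(A) x = T A x - A T x for x in E.  Hence D is a derivation on each E in
   P_L, so everywhere by density. *)

Require Import Defs.
From HB Require Import structures.
From mathcomp Require Import all_boot all_order all_algebra.
From mathcomp Require Import complex lra.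
From mathcomp Require Import boolp classical_sets functions reals.
From mathcomp Require Import topology normedtype.

Set Implicit Arguments.
Unset Strict Implicit.
Unset Printing Implicit Defensive.

Import Order.TTheory GRing.Theory Num.Theory.
Import numFieldNormedType.Exports.

Local Open Scope classical_set_scope.
Local Open Scope ring_scope.

(** * The Hahn-Banach theorem *)

Section HahnBanach.
Context (R : realType) (V : lmodType R).
Implicit Types (q : V -> R) (C : V -> R -> Prop).

Definition sublinear q :=
  (forall x y, q (x + y) <= q x + q y) /\
  (forall t x, 0 <= t -> q (t *: x) <= t * q x).

(** A cone in the product of [V] and [R], written as a relation: [C c s] demands that the functional
    sought be at least [s] at [c]. *)
Definition convex_cone C :=
  [/\ C 0 0, forall c s d t, C c s -> C d t -> C (c + d) (s + t) &
      forall r c s, 0 <= r -> C c s -> C (r *: c) (r * s)].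

Lemma sublinear0 q : sublinear q -> q 0 = 0.
Proof.
case=> qD qZ; have := qD 0 0; have := qZ 0 0 (lexx _).
rewrite scale0r addr0; lra.
Qed.

Lemma sublinear_opp q x : sublinear q -> - q (- x) <= q x.
Proof. by move=> qS; have [/(_ x (- x))] := qS; rewrite subrr sublinear0//; lra. Qed.

(** A linear f with f <= q and f c >= s whenever [C c s] satisfies f x = f (x + c) - f c <= q (x +
    c) - s, so f lies below this infimum. *)
Definition inf_translates q C x :=
  inf [set r | exists c s, C c s /\ r = q (x + c) - s].

Section InfTranslates.
Context q C (qS : sublinear q) (CC : convex_cone C) (Cq : forall c s, C c s -> s <= q c).

Lemma inf_translates_le c s x : C c s -> inf_translates q C x <= q (x + c) - s.
Proof.
move=> Ccs; apply: ge_inf; last by exists c, s.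
(* A lower bound of the set, as t <= q d <= q (x + d) + q (- x). *)
exists (- q (- x)) => _ [d [t [Cdt ->]]].
have [/(_ (x + d) (- x)) + _] := qS; rewrite [x + d]addrC addrK.
have := Cq Cdt; lra.
Qed.

Lemma le_inf_translates m x :
  (forall c s, C c s -> m <= q (x + c) - s) -> m <= inf_translates q C x.
Proof.
move=> mq; apply: lb_le_inf; last by move=> _ [c [s [Ccs ->]]]; exact: mq.
by have [C0 _ _] := CC; exists (q (x + 0) - 0), 0, 0.
Qed.

Lemma inf_translates_base x : inf_translates q C x <= q x.
Proof. by have [/(inf_translates_le x)] := CC; rewrite addr0 subr0. Qed.

Lemma inf_translates_sublinear : sublinear (inf_translates q C).
Proof.
have [C0 CD CZ] := CC; have [qD qZ] := qS; split=> [x y|t x].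
  suff: inf_translates q C (x + y) - inf_translates q C x <= inf_translates q C y.
    lra.
  apply: le_inf_translates => d t Cdt.
  suff: inf_translates q C (x + y) - q (y + d) + t <= inf_translates q C x by lra.
  apply: le_inf_translates => c s Ccs.
  have := inf_translates_le (x + y) (CD _ _ _ _ Ccs Cdt).
  rewrite addrACA; have := qD (x + c) (y + d); lra.
rewrite le_eqVlt => /predU1P[<-|t0].
  rewrite scale0r mul0r; have := inf_translates_base 0.
  by rewrite (sublinear0 qS).
rewrite mulrC -ler_pdivrMr//; apply: le_inf_translates => c s Ccs.
rewrite ler_pdivrMr//.
apply: (le_trans (inf_translates_le (t *: x) (CZ t _ _ (ltW t0) Ccs))).
rewrite -scalerDr; have := qZ t (x + c) (ltW t0); lra.
Qed.

Lemma inf_translates_opp c s : C c s -> inf_translates q C (- c) <= - s.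
Proof. by move=> /(inf_translates_le (- c)); rewrite addNr (sublinear0 qS) sub0r. Qed.

End InfTranslates.

(** Zorn's lemma for the reversed pointwise order: a nonempty chain is bounded by its pointwise
    infimum, which is finite since every sublinear t <= p has t x >= - p (- x). *)
Lemma minimal_sublinear p : sublinear p ->
  exists q, [/\ sublinear q, forall x, q x <= p x &
    forall q', sublinear q' -> (forall x, q' x <= q x) -> forall x, q' x = q x].
Proof.
move=> pS; pose Q q := sublinear q /\ forall x, q x <= p x; pose T := {q | Q q}.
pose r (s t : T) := `[< forall x, sval t x <= sval s x >].
have [| | | |[q [qS qp]] qmin] := @Zorn T r.
- by move=> t; apply/asboolP => x.
- move=> s t u /asboolP st /asboolP tu; apply/asboolP => x.
  exact: le_trans (tu x) (st x).
- move=> [s sP] [t tP] /asboolP st /asboolP ts; apply: eq_exist.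
  by apply/funext => x; apply/eqP; rewrite eq_le st ts.
- move=> A Atot; have [[t0 At0]|A0] := pselect (exists t, A t); last first.
    exists (exist Q p (conj pS (fun x => lexx _))) => s As.
    by case: A0; exists s.
  pose E x := [set sval t x | t in A].
  have lbE x : lbound (E x) (- p (- x)).
    move=> _ [[t [tS tp]] At <-] /=.
    by have := sublinear_opp x tS; have := tp (- x); lra.
  have infE t x : A t -> inf (E x) <= sval t x.
    by move=> At; apply: ge_inf; [exists (- p (- x)); exact: lbE | exists t].
  have le_infE m x : (forall t, A t -> m <= sval t x) -> m <= inf (E x).
    move=> mE; apply: lb_le_inf; first by exists (sval t0 x), t0.
    by move=> _ [t At <-]; exact: mE.
  have EP : Q (fun x => inf (E x)).
    split; last by move=> x; apply: le_trans (infE t0 x At0) _; have [] := svalP t0.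
    split=> [x y|t x t_ge0].
      suff: inf (E (x + y)) - inf (E x) <= inf (E y) by lra.
      apply: (le_infE) => t At; suff: inf (E (x + y)) - sval t y <= inf (E x) by lra.
      apply: (le_infE) => s As.
      (* The smaller of [s] and [t] in the chain serves as [u], so subadditivity of a single
         functional suffices. *)
      have [u [Au us ut]] : exists u, [/\ A u, sval u x <= sval s x & sval u y <= sval t y].
        by have [/asboolP st|/asboolP ts] := Atot _ _ As At; [exists t|exists s].
      have [[/(_ x y) + _] _] := svalP u; have := infE u (x + y) Au; lra.
    have [t_gt0|t_le0] := ltP 0 t; last first.
      have -> : t = 0 by lra.
      rewrite scale0r mul0r; apply: le_trans (infE _ _ At0) _.
      by have [/sublinear0 ->] := svalP t0.
    rewrite mulrC -ler_pdivrMr//; apply: (le_infE) => s As; rewrite ler_pdivrMr// mulrC.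
    apply: le_trans (infE _ _ As) _; have [[_ sZ] _] := svalP s; exact: sZ.
  exists (exist Q _ EP) => s As; apply/asboolP => x; exact: infE.
exists q; split=> // q' q'S q'q x.
have q'P : Q q'.
  by split=> // y; apply: le_trans (q'q y) (qp y).
have rq : r (exist Q q (conj qS qp)) (exist Q q' q'P) by exact/asboolP.
by have /(congr1 (fun t => sval t x)) := qmin _ rq.
Qed.

(* A minimal sublinear functional [q] is linear: lowering it along the ray of
   [a], i.e. to [inf_(t >= 0) q (x + t a) - t q a], must not change its value at
   [- a], so that [q (- a) = - q a].  Lowering [p] along [C] beforehand makes
   the functional dominate [C]. *)
Lemma hahn_banach_cone p C : sublinear p -> convex_cone C ->
  (forall c s, C c s -> s <= p c) ->
  exists f : {scalar V}, (forall x, f x <= p x) /\ (forall c s, C c s -> s <= f c).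
Proof.
move=> pS CC Cp.
have [q [qS qp qmin]] := minimal_sublinear (inf_translates_sublinear pS CC Cp).
have [qD qZ] := qS.
have qN a : q (- a) = - q a.
  pose D c s := exists2 t, 0 <= t & c = t *: a /\ s = t * q a.
  have DC : convex_cone D.
    split; first by exists 0 => //; rewrite scale0r mul0r.
    - move=> _ _ _ _ [t t0 [-> ->]] [u u0 [-> ->]].
      by exists (t + u); rewrite ?addr_ge0// scalerDl mulrDl.
    - move=> r _ _ r0 [t t0 [-> ->]].
      by exists (r * t); rewrite ?mulr_ge0// scalerA mulrA.
  have Da : D a (q a) by exists 1 => //; rewrite scale1r mul1r.
  have Dq c s : D c s -> s <= q c.
    move=> [t]; rewrite le_eqVlt => /predU1P[<- [-> ->]|t0 [-> ->]].
      by rewrite scale0r mul0r sublinear0.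
    rewrite mulrC -ler_pdivlMr// mulrC -[a in leLHS](scalerK (lt0r_neq0 t0)).
    by apply: (qZ); rewrite invr_ge0 ltW.
  have := inf_translates_opp qS Dq Da.
  rewrite (qmin _ (inf_translates_sublinear qS DC Dq) (inf_translates_base qS DC Dq)).
  have := sublinear_opp a qS; lra.
have qadd x y : q (x + y) = q x + q y.
  have := qD x y; have := qD (- x) (- y); rewrite -opprD !qN; lra.
have qpos t x : 0 <= t -> q (t *: x) = t * q x.
  move=> t0; have := qZ _ x t0; have := qZ _ (- x) t0; rewrite scalerN !qN; lra.
have qlin : scalar q.
  move=> t x y; rewrite qadd; congr (_ + _).
  have [t0|/ltW t0] := leP 0 t; first exact: qpos.
  by rewrite -{1}[t]opprK scaleNr qN qpos ?oppr_ge0// mulNr opprK.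
pose fM := GRing.isLinear.Build R V R^o *%R q qlin.
pose f : {scalar V} := HB.pack q fM.
exists f; split=> [x|c s Ccs].
  exact: le_trans (qp x) (inf_translates_base pS CC Cp x).
rewrite -[f c]opprK -[- f c]/(- q c) -qN lerNr.
exact: le_trans (qp _) (inf_translates_opp pS Cp Ccs).
Qed.

End HahnBanach.

(** * Separation of a vector from a subspace by a bounded functional *)

Lemma real_separation (R : realType) (V : lmodType R) (p : V -> R) (N : set V)
    (z : V) (e : R) :
    sublinear p -> (forall x, 0 <= p x) ->
    N 0 -> (forall x y, N x -> N y -> N (x + y)) -> (forall t x, N x -> N (t *: x)) ->
    0 < e -> (forall x, N x -> e <= p (x + z)) ->
  exists f : {scalar V},
    [/\ forall x, f x <= p x, forall x, N x -> f x = 0 & 0 < f z].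
Proof.
move=> pS p0 N0 ND NZ e0 ep.
(* The cone generated by the pairs (x, 0) with x in [N] and by (z, e): a functional dominating it is
   nonnegative on [N], hence zero there because [N] is symmetric, and at least [e] at [z]. *)
pose C c s := exists x t, [/\ N x, 0 <= t, c = x + t *: z & s = t * e].
have [||f [fp fC]] := @hahn_banach_cone R V p C pS.
- split; first by exists 0, 0; rewrite scale0r addr0 mul0r.
  + move=> _ _ _ _ [x [t [Nx t0 -> ->]]] [y [u [Ny u0 -> ->]]].
    exists (x + y), (t + u); rewrite addr_ge0// scalerDl mulrDl addrACA.
    by split=> //; exact: ND.
  + move=> r _ _ r0 [x [t [Nx t0 -> ->]]].
    exists (r *: x), (r * t); rewrite mulr_ge0// scalerDr scalerA mulrA.
    by split=> //; exact: NZ.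
- move=> _ _ [x [t [Nx + -> ->]]]; rewrite le_eqVlt => /predU1P[<-|t0].
    by rewrite mul0r.
  have := ep _ (NZ t^-1 _ Nx); rewrite mulrC -ler_pdivlMr// => /le_trans; apply.
  rewrite mulrC; have [_ /(_ t^-1 (x + t *: z))] := pS.
  by rewrite scalerDr scalerK ?lt0r_neq0//; apply; rewrite invr_ge0 ltW.
exists f; split=> // [x Nx|]; last first.
  by apply: lt_le_trans e0 (fC _ _ _); exists 0, 1; rewrite add0r scale1r mul1r.
have f0 y : N y -> 0 <= f y.
  by move=> Ny; apply: fC; exists y, 0; rewrite scale0r addr0 mul0r.
apply: le_anti; rewrite f0// -oppr_ge0 -raddfN -scaleN1r f0//.
exact: NZ.
Qed.

(** An alias of [V], so that the scalars restricted to [R] form a second module structure beside the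
    complex one. *)
Definition realification (R : realType) (V : lmodType R[i]) : Type := V.

Section Realification.
Context (R : realType) (V : lmodType R[i]).

HB.instance Definition _ := GRing.Zmodule.on (realification V).

Let scale (t : R) (x : realification V) : realification V := t%:C%C *: (x : V).

Let scaleA a b x : scale a (scale b x) = scale (a * b) x.
Proof. by rewrite /scale scalerA rmorphM. Qed.

Let scale1 : left_id 1 scale.
Proof. by move=> x; rewrite /scale rmorph1 scale1r. Qed.

Let scaleDr : right_distributive scale +%R.
Proof. by move=> t x y; rewrite /scale scalerDr. Qed.

Let scaleDl x : {morph scale^~ x : a b / a + b}.
Proof. by move=> a b; rewrite /scale rmorphD scalerDl. Qed.

HB.instance Definition _ := GRing.Zmodule_isLmodule.Build R (realification V)
  scaleA scale1 scaleDr scaleDl.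

Lemma realification_scaleE t (x : realification V) : t *: x = t%:C%C *: (x : V).
Proof. by []. Qed.

End Realification.

Lemma subspace_dist (K : numFieldType) (X : normedModType K) (N : set X) z :
  Defs.subspace N -> ~ N z -> exists2 e : K, 0 < e & forall x, N x -> e <= `|x + z|.
Proof.
move=> [[/set_mem N0 NL] Ncl] Nz.
have /nbhs_ballP[e /= e0 eN] : nbhs z (~` N).
  by apply: open_nbhs_nbhs; split=> //; exact: closed_openC.
exists e => // x Nx; have [//|xz] := real_leP (gtr0_real e0) (normr_real (x + z)).
exfalso; apply: (eN (- x)).
  by rewrite -ball_normE /ball_/= opprK addrC.
have := NL (-1) x 0 (mem_set Nx) (mem_set N0).
by rewrite addr0 scaleN1r => /set_mem.
Qed.

Definition bounded_functional (K : numFieldType) (X : normedModType K) (g : {scalar X}) :=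
  exists M : K, forall x, `|g x| <= M * `|x|.

Lemma normalized_functional (K : numFieldType) (X : normedModType K) (N : set X) z
    (g : {scalar X}) :
  bounded_functional g -> (forall x, N x -> g x = 0) -> g z != 0 ->
  exists h : {scalar X},
    [/\ bounded_functional h, forall x, N x -> h x = 0 & h z = 1].
Proof.
move=> [M gM] gN gz.
have hlin : scalar (fun x => (g z)^-1 * g x).
  by move=> t x y; rewrite linearP mulrDr mulrCA.
pose hM := GRing.isLinear.Build K X K^o *%R _ hlin.
pose h : {scalar X} := HB.pack (fun x => (g z)^-1 * g x) hM.
exists h; split=> [|x Nx|]; last 2 first.
- by rewrite -[LHS]/((g z)^-1 * g x) (gN x)// mulr0.
- by rewrite -[LHS]/((g z)^-1 * g z) mulVf.
exists (`|(g z)^-1| * M) => x; rewrite -[h x]/((g z)^-1 * g x) normrM -mulrA.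
by rewrite ler_wpM2l.
Qed.

(** Real scalars: [real_separation] for the norm. Complex scalars: a real-linear f is found on the
    realification, and g x = f x - i f (i x) is complex linear with real part f. *)
Lemma separating_functional (R : realType) (K : numFieldType) (hK : scalar_field R K)
    (X : normedModType K) (N : set X) z : Defs.subspace N -> ~ N z ->
  exists g : {scalar X},
    [/\ bounded_functional g, forall x, N x -> g x = 0 & g z = 1].
Proof.
move=> Nsub Nz; have [e e0 eN] := subspace_dist Nsub Nz.
have [[/set_mem N0 NL] _] := Nsub.
have ND x y : N x -> N y -> N (x + y).
  by move=> /mem_set Nx /mem_set Ny; have := NL 1 x y Nx Ny; rewrite scale1r => /set_mem.
have NZ t x : N x -> N (t *: x).
  by move=> /mem_set Nx; have := NL t x 0 Nx (mem_set N0); rewrite addr0 => /set_mem.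
move: X N z Nsub Nz e e0 eN N0 NL ND NZ; case: hK => X N z Nsub Nz e e0 eN N0 _ ND NZ.
  have pS : sublinear (fun x : X => `|x|).
    split=> [x y|t x t0]; first exact: ler_normD.
    by rewrite normrZ ger0_norm.
  have [//|f [fp fN fz]] := real_separation pS _ N0 ND NZ e0 eN.
  apply: (normalized_functional (g := f)) => //; last exact: lt0r_neq0.
  exists 1 => x; rewrite mul1r ler_norml fp andbT lerNl -raddfN.
  by rewrite -(normrN x) fp.
pose p (x : realification X) : R := complex.Re `|x : X|.
have pE (x : X) : `|x| = (p x)%:C%C.
  by apply/esym/eqP; rewrite eq_complex/= eqxx/= (ger0_Im (normr_ge0 x)).
have pS : sublinear p.
  split=> [x y|t x t0]; first by rewrite -lecR rmorphD/= -!pE ler_normD.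
  rewrite -lecR rmorphM/= -!pE realification_scaleE normrZ.
  by rewrite ger0_norm ?ler0c.
have p0 x : 0 <= p x by rewrite -ler0c -pE.
have eE : e = (complex.Re e)%:C%C.
  by apply/esym/eqP; rewrite eq_complex/= eqxx/= (ger0_Im (ltW e0)).
have ReE0 : 0 < complex.Re e by move: e0; rewrite eE ltcR.
have NZ' t (x : realification X) : N x -> N (t *: x) by move=> /NZ; apply.
have [f [fD fZ fp fN fz]] : exists f : X -> R,
    [/\ forall x y, f (x + y) = f x + f y, forall t x, f (t%:C%C *: x) = t * f x,
      forall x, f x <= p x, forall x, N x -> f x = 0 & 0 < f z].
  have [x Nx|f [fp fN fz]] :=
      @real_separation R (realification X) p N z (complex.Re e) pS p0 N0 ND NZ' ReE0.
    by rewrite -lecR -eE -pE; exact: eN.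
  exists f; split=> //; first exact: (@raddfD _ _ f).
  by move=> t x; exact: (@linearZ_LR _ _ _ _ f t x).
have fN1 x : f (- x) = - f x.
  by have := fZ (-1) x; rewrite rmorphN rmorph1 scaleN1r mulN1r.
pose g (x : X) : R[i] := (f x -i* f ('i *: x)%C)%C.
have fiE (a b : R) (x : X) : f ((a +i* b)%C *: x) = a * f x + b * f ('i%C *: x).
  have -> : (a +i* b)%C *: x = a%:C%C *: x + b%:C%C *: ('i%C *: x).
    by rewrite scalerA -scalerDl; congr (_ *: _); simpc.
  by rewrite fD !fZ.
have g_lin : scalar g.
  move=> [a b] x y; rewrite /g scalerDr scalerA !fD.
  have -> : 'i%C * (a +i* b)%C = ((- b) +i* a)%C by simpc.
  rewrite (fiE a b) (fiE (- b) a); simpc; congr (_ +i* _)%C; lra.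
pose gM := GRing.isLinear.Build _ X _ *%R g g_lin.
pose h : {scalar X} := HB.pack g gM.
have hE x : h x = g x by [].
apply: (normalized_functional (g := h)) => [|x Nx|].
(* The bound 2 comes from |g x| <= |f x| + |f (i x)|, each term being at most |x|. *)
- exists (1 + 1) => x; rewrite hE.
  have fnorm (y : X) : `|(f y)%:C%C| <= `|y|.
    rewrite pE normc_def/= expr0n/= addr0 sqrtr_sqr lecR ler_norml fp andbT lerNl.
    rewrite -fN1; apply: le_trans (fp _) _; rewrite -lecR -!pE.
    by rewrite normrN.
  have -> : g x = (f x)%:C%C - 'i%C * (f ('i%C *: x))%:C%C.
    by rewrite /g; simpc.
  rewrite mulrDl mul1r (le_trans (ler_normB _ _))// lerD//.
  rewrite normrM; have -> : `|'i%C : R[i]| = 1.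
    by rewrite normc_def/= expr0n/= add0r expr1n sqrtr1.
  rewrite mul1r (le_trans (fnorm _))// normrZ.
  by rewrite normc_def/= expr0n/= add0r expr1n sqrtr1 mul1r.
- by rewrite hE /g !fN//; [simpc|exact: NZ].
- by rewrite hE eq_complex/= (gt_eqF fz).
Qed.

(** * Jordan derivability in rings *)

Section InnerDerivation.
Context (S B : pzRingType) (v : {rmorphism S -> B}).

(** [v] will be the inclusion of [Alg L] in B(X); the implementing element [t] may lie outside the
    algebra. *)
Definition inner_derivation (t : B) (a : S) : B := t * v a - v a * t.

Lemma inner_derivation_is_additive t : zmod_morphism (inner_derivation t).
Proof.
move=> a b; rewrite /inner_derivation rmorphB mulrBr mulrBl !opprB.
by rewrite [v b * t - _]addrC addrACA [- _ + v b * t]addrC.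
Qed.

HB.instance Definition _ t :=
  GRing.isZmodMorphism.Build S B (inner_derivation t) (inner_derivation_is_additive t).

Lemma inner_derivationM t a b :
  inner_derivation t (a * b) = inner_derivation t a * v b + v a * inner_derivation t b.
Proof. by rewrite /inner_derivation rmorphM mulrBl mulrBr !mulrA addrA subrK. Qed.

End InnerDerivation.

Section JordanDerivable.
Context (S B : pzRingType) (v : {rmorphism S -> B}).
Hypothesis B2 : forall b : B, b + b = 0 -> b = 0.
Implicit Types D : {additive S -> B}.

(** Stated for one pair, so that the rule can be carried by additivity to pairs that do not
    anticommute. *)
Definition jordan_rule D a b :=
  D (a * b + b * a) = D a * v b + v a * D b + (D b * v a + v b * D a).

Definition jordan_at_zero D := forall a b, a * b + b * a = 0 -> jordan_rule D a b.

Lemma jordan_rule_inner t a b : jordan_rule (inner_derivation v t) a b.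
Proof. by rewrite /jordan_rule raddfD/= !inner_derivationM. Qed.

Lemma jordan_ruleB D1 D2 a b :
  jordan_rule D1 a b -> jordan_rule D2 a b -> jordan_rule (D1 \- D2) a b.
Proof.
rewrite /jordan_rule /= => -> ->.
rewrite !mulrBl !mulrBr opprD opprD [in LHS]opprD.
by rewrite [LHS]addrACA; congr (_ + _); rewrite [LHS]addrACA.
Qed.

Lemma jordan_ruleD D1 D2 a b :
  jordan_rule D1 a b -> jordan_rule D2 a b -> jordan_rule (D1 \+ D2) a b.
Proof.
rewrite /jordan_rule /= => -> ->; rewrite !mulrDl !mulrDr.
by rewrite [LHS]addrACA; congr (_ + _); rewrite [LHS]addrACA.
Qed.

Lemma jordan_ruleDl D a a' b :
  jordan_rule D a b -> jordan_rule D a' b -> jordan_rule D (a + a') b.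
Proof.
rewrite /jordan_rule => ab a'b; rewrite mulrDl mulrDr addrACA raddfD ab a'b.
rewrite !raddfD !mulrDl !mulrDr /=.
by rewrite [LHS]addrACA; congr (_ + _); rewrite [LHS]addrACA.
Qed.

Lemma jordan_rule_sym D a b : jordan_rule D a b -> jordan_rule D b a.
Proof. by rewrite /jordan_rule addrC => ->; rewrite addrC. Qed.

(** Multiplying y p = - p y by p on either side shows that y p and p y both equal - p y p; their sum
    being 0, both vanish by [B2]. *)
Lemma anticommute_idempotent (y p : B) : p * p = p -> y * p + p * y = 0 ->
  y * p = 0 /\ p * y = 0.
Proof.
move=> pp yp; have yp' : y * p = - (p * y) by apply/eqP; rewrite -addr_eq0 yp.
have pyp : p * y * p = - (p * y) by rewrite -mulrA yp' mulrN mulrA pp.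
have ypE : y * p = p * y by rewrite -{1}pp mulrA yp' mulNr pyp opprK.
by have := yp; rewrite ypE => /B2 ->.
Qed.

Section AtZero.
Context D (DJ : jordan_at_zero D) (D1 : D 1 = 0).

Lemma jordan_at_zero_eq0 a b : a * b + b * a = 0 ->
  D a * v b + v a * D b + (D b * v a + v b * D a) = 0.
Proof. by move=> ab; rewrite -DJ// ab raddf0. Qed.

Section Idempotent.
Context (e : S) (ee : e * e = e).

Let q := 1 - e.
Let eq0 : e * q = 0. Proof. by rewrite mulrBr mulr1 ee subrr. Qed.
Let qe0 : q * e = 0. Proof. by rewrite mulrBl mul1r ee subrr. Qed.
Let qq : q * q = q. Proof. by rewrite {1}/q mulrBl mul1r eq0 subr0. Qed.
Let vee : v e * v e = v e. Proof. by rewrite -rmorphM ee. Qed.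
Let Dq : D q = - D e. Proof. by rewrite raddfB/= D1 sub0r. Qed.
Let vq : v q = 1 - v e. Proof. by rewrite rmorphB rmorph1. Qed.

(** As D (1 - e) = - D e, the pair e, 1 - e yields twice the difference of the two sides. *)
Lemma jordan_idempotent : D e = D e * v e + v e * D e.
Proof.
have := @jordan_at_zero_eq0 e q; rewrite eq0 qe0 addr0 => /(_ erefl).
rewrite Dq vq mulrBr mulr1 mulrN mulNr mulrBl mul1r.
rewrite [- _ + (_ - _)]addrCA [_ + (- _ - _)]addrA.
by move=> h; apply: subr0_eq; apply: B2; rewrite opprD [D e + _]addrA.
Qed.

Lemma jordan_idempotent_corner : v e * D e * v e = 0.
Proof.
have := congr1 (fun w => v e * w * v e) jordan_idempotent.
rewrite mulrDr mulrDl -!mulrA vee [v e * (v e * _)]mulrA vee => h.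
by apply: (addrI (v e * (D e * v e))); rewrite addr0 -h.
Qed.

(** Because e (D e) e = 0, the double commutator reduces to (D e) e + e (D e). *)
Lemma inner_derivation_idempotent :
  inner_derivation v (D e * v e - v e * D e) e = D e.
Proof.
rewrite /inner_derivation mulrBl mulrBr -mulrA vee !mulrA vee.
by rewrite jordan_idempotent_corner subr0 sub0r opprK -jordan_idempotent.
Qed.

Let eDq : e + q = 1. Proof. by rewrite addrC subrK. Qed.

(* The three Peirce pieces of [a] anticommute with [1 - e], [e] and [2 e - 1]
   respectively. *)
Lemma jordan_rule_idempotent0 a : D e = 0 -> jordan_rule D a e.
Proof.
move=> De; have Dq0 : D q = 0 by rewrite Dq De oppr0.
pose off := e * a * q + q * a * e.
have -> : a = e * a * e + q * a * q + off.
  rewrite addrACA -!mulrDr [q + e]addrC eDq !mulr1.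
  by rewrite -mulrDl eDq mul1r.
suff rule0 c : D (c * e + e * c) = D c * v e + v e * D c -> jordan_rule D c e.
  apply: jordan_ruleDl; first apply: jordan_ruleDl; apply: rule0.
  - pose c := e * a * e; rewrite -/c.
    have ce : c * e = c by rewrite /c -mulrA ee.
    have ec : e * c = c by rewrite /c !mulrA ee.
    have cq : c * q = 0 by rewrite -ce -mulrA eq0 mulr0.
    have qc : q * c = 0 by rewrite -ec mulrA qe0 mul0r.
    (* This pair gives D c q + q D c = 0, hence D c q = q D c = 0, that is, D c = D c e = e D c. *)
    have := @jordan_at_zero_eq0 c q; rewrite cq qc addr0 => /(_ erefl).
    rewrite Dq0 mulr0 mul0r addr0 add0r => /anticommute_idempotent[|+ +].
      by rewrite -rmorphM qq.
    rewrite vq mulrBr mulr1 mulrBl mul1r => /subr0_eq <- /subr0_eq <-.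
    by rewrite ce ec raddfD.
  - pose c := q * a * q; rewrite -/c.
    have ce : c * e = 0 by rewrite /c -mulrA qe0 mulr0.
    have ec : e * c = 0 by rewrite /c !mulrA eq0 !mul0r.
    have := @jordan_at_zero_eq0 c e; rewrite ce ec addr0 => /(_ erefl).
    by rewrite De mulr0 mul0r addr0 add0r raddf0.
  - have offE : off * e + e * off = off.
      rewrite /off (mulrDl _ _ e) (mulrDr e (e * a * q)) -!mulrA qe0 ee !mulr0 add0r.
      by rewrite !mulrA ee eq0 !mul0r addr0 addrC.
    clearbody off; have := @jordan_at_zero_eq0 off (e + (e - 1)).
    rewrite !mulrDr !mulrDl mulrN mulNr mulr1 mul1r.
    rewrite addrACA offE addrACA offE -opprD addrA subrr => /(_ erefl).
    have -> : D (e + (e - 1)) = 0 by rewrite raddfD raddfB/= De D1 subr0 addr0.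
    rewrite mulr0 mul0r addr0 add0r.
    rewrite rmorphD rmorphB rmorph1 !mulrDr !mulrDl mulrN mulNr mulr1 mul1r.
    rewrite addrACA [X in _ + X]addrACA -opprD => h.
    move: (_ + v e * _) h => w h; apply/esym/subr0_eq/B2.
    by rewrite addrACA -opprD -addrA.
by rewrite /jordan_rule De mulr0 mul0r addr0 add0r.
Qed.

(** The map b -> b e + e b, applied twice to a, gives a e + e a + 2 e a e; [D] commutes with this
    map, and the factor 2 cancels. *)
Lemma jordan_triple_idempotent0 a : D e = 0 -> D (e * a * e) = v e * D a * v e.
Proof.
move=> De.
have rule0 b : D (b * e + e * b) = D b * v e + v e * D b.
  by rewrite (jordan_rule_idempotent0 _ De) De mulr0 mul0r addr0 add0r.
have dbl (T : pzRingType) (p b : T) : p * p = p ->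
    (b * p + p * b) * p + p * (b * p + p * b) = b * p + p * b + (p * b * p + p * b * p).
  move=> pp; rewrite mulrDl mulrDr -[b * p * p]mulrA [p * (p * b)]mulrA pp mulrA.
  by rewrite [RHS]addrACA [p * b + _ in RHS]addrC.
have := rule0 (a * e + e * a); rewrite dbl// raddfD !rule0 dbl// => /addrI.
rewrite raddfD => /eqP; rewrite -subr_eq0 opprD addrACA => /eqP/B2/eqP.
by rewrite subr_eq0 => /eqP.
Qed.

End Idempotent.

End AtZero.

Lemma jordan_at_zeroB_inner D t : jordan_at_zero D ->
  jordan_at_zero (D \- inner_derivation v t).
Proof. by move=> DJ a b /DJ ab; apply: jordan_ruleB ab (jordan_rule_inner _ _ _). Qed.

(* Subtracting a suitable inner derivation reduces to the case [D e = 0]. *)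
Lemma jordan_rule_idempotent D e a :
  jordan_at_zero D -> D 1 = 0 -> e * e = e -> jordan_rule D a e.
Proof.
move=> DJ D1 ee; pose t := D e * v e - v e * D e.
have D'1 : (D \- inner_derivation v t) 1 = 0.
  by rewrite /= D1 /inner_derivation rmorph1 mulr1 mul1r subrr subr0.
have D'e : (D \- inner_derivation v t) e = 0.
  by rewrite /= inner_derivation_idempotent// subrr.
have D'J := jordan_at_zeroB_inner t DJ.
have := jordan_ruleD (jordan_rule_idempotent0 D'J D'1 ee a D'e)
                     (jordan_rule_inner t a e).
by rewrite /jordan_rule /= !subrK.
Qed.

(** With c = D 1 and d = D e, the identity for e and 1 - e, multiplied by e on the left and on the
    right, gives e c + e c e = 2 e d e = c e + e c e. *)
Lemma jordan_at_zero_commute1 D e : jordan_at_zero D -> e * e = e ->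
  v e * D 1 = D 1 * v e.
Proof.
move=> DJ ee; have vee : v e * v e = v e by rewrite -rmorphM ee.
have e0 : e * (1 - e) = 0 by rewrite mulrBr mulr1 ee subrr.
have e0' : (1 - e) * e = 0 by rewrite mulrBl mul1r ee subrr.
have := @jordan_at_zero_eq0 D DJ e (1 - e); rewrite e0 e0' addr0 => /(_ erefl).
rewrite !raddfB/= rmorph1; move: (D e) (D 1) (v e) vee => d c p pp h.
have hl := congr1 (fun w => p * w) h; have hr := congr1 (fun w => w * p) h.
move: hl hr.
rewrite !(mulrDl, mulrDr, mulrN, mulNr, mulr1, mul1r, mulr0, mul0r, mulrA).
rewrite -![_ * p * p]mulrA !pp.
rewrite !subrr add0r addr0 [p * d - _ + _]addrC [p * c - _ + _]addrA subrK.
rewrite [c * p - _ + _]addrA subrK [p * c * p - _ + _]addrC => /addr0_eq hl /addr0_eq hr.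
by apply: (addIr (- (p * d * p))); apply: oppr_inj; rewrite hl hr.
Qed.

End JordanDerivable.

(** * Operators and subspace lattices *)

Section Operators.
Context (K : numFieldType) (X : normedModType K).
Implicit Types (S T : 'B(X)) (x y : X).

HB.instance Definition _ T :=
  GRing.isLinear.Build K X X *:%R T (bounded_operator_linear T).

Lemma opD S T x : (S + T) x = S x + T x. Proof. by []. Qed.
Lemma opB S T x : (S - T) x = S x - T x. Proof. by []. Qed.
Lemma opM S T x : (S * T) x = S (T x). Proof. by []. Qed.
Lemma opZ k T x : (k *: T) x = k *: T x. Proof. by []. Qed.
Lemma op0 x : (0 : 'B(X)) x = 0. Proof. by []. Qed.
Lemma opZr T k x : T (k *: x) = k *: T x. Proof. exact: linearZ_LR. Qed.
Lemma opDr T x y : T (x + y) = T x + T y. Proof. exact: raddfD. Qed.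
Lemma opBr T x y : T (x - y) = T x - T y. Proof. exact: raddfB. Qed.
Lemma opP T k x y : T (k *: x + y) = k *: T x + T y.
Proof. exact: bounded_operator_linear. Qed.

Lemma op_2torsion_free T : T + T = 0 -> T = 0.
Proof.
by rewrite -mulr2n -scaler_nat => /eqP; rewrite scaler_eq0 pnatr_eq0 => /eqP.
Qed.

Lemma rank_one_bounded_linear (g : {scalar X}) x :
  bounded_functional g -> (fun y => g y *: x) \in @bounded_linear K X.
Proof.
move=> [M gM]; apply/asboolP; split=> [k u w|].
  by rewrite linearP scalerDl scalerA.
exists (M * `|x|) => y; rewrite normrZ -mulrA (mulrC `|x|) mulrA.
by rewrite ler_wpM2r.
Qed.

Lemma ker_subspace T : Defs.subspace [set x | T x = 0].
Proof.
split.
  split=> [|k x y]; first by apply/mem_set; rewrite /= raddf0.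
  move=> /set_mem/= Tx /set_mem/= Ty; apply/mem_set.
  by rewrite /= linearP/= Tx Ty scaler0 addr0.
have Tc : continuous T.
  apply/linear_bounded_continuous/bounded_funP => r.
  have [M TM] := bounded_operator_bounded T; exists (`|M| * r) => x xr.
  (* [M] need not be nonnegative, but M |x| is, since it bounds a norm. *)
  have := TM x; rewrite -[M * _]ger0_norm ?(le_trans _ (TM x))// normrM normr_id.
  by move=> /le_trans; apply; rewrite ler_wpM2l.
have -> : [set x | T x = 0] = T @^-1` [set 0] by [].
apply: preimage_closed => //.
exact: accessible_closed_set1 (hausdorff_accessible (@norm_hausdorff _ _)) 0.
Qed.

(** The kernel of a bounded operator is a closed subspace, so it contains the join of its
    subsets. *)
Lemma eq0_on_join (F : set (set X)) T : join F = setT ->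
  (forall E, F E -> forall x, E x -> T x = 0) -> T = 0.
Proof.
move=> FT T0; apply: bounded_operatorP => x.
have [kerL kercl] := ker_subspace T.
suff : [set x | T x = 0] x by [].
have : join F x by rewrite FT.
rewrite ((closure_id _).1 kercl); apply: closure_subset.
by apply: smallest_sub => // y [E FE Ey]; exact: T0 Ey.
Qed.

End Operators.

(* The hypothesis [g0] is how [g] vanishes on [E_-]. *)
Section Local.
Context (K : numFieldType) (X : normedModType K) (L : subspace_lattice X).
Context (E : set X) (g : {scalar X}) (z : X).
Hypotheses (LE : members L E) (gb : bounded_functional g) (Ez : E z) (gz : g z = 1).
Hypothesis (g0 : forall F x, members L F -> ~ E `<=` F -> F x -> g x = 0).

Let linZ := (@opZr K X, fun k x => linearZ_LR g k x : g (k *: x) = k * g x).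

Let v : {rmorphism Alg L -> 'B(X)} := val.

Let E0 : E 0. Proof. by have [[/set_mem]] := lattice_subspace LE. Qed.

Let EP k x y : E x -> E y -> E (k *: x + y).
Proof.
move=> /mem_set Ex /mem_set Ey.
by have [[_ EL] _] := lattice_subspace LE; apply/set_mem/EL.
Qed.

Let ED x y : E x -> E y -> E (x + y).
Proof. by move=> Ex; rewrite -[x]scale1r; exact: EP. Qed.

Let EA (A : Alg L) x : E x -> E (A x).
Proof. by case: A => A /= /asboolP AL; exact: AL. Qed.

(** A member F either contains E, hence x, or does not contain E, and then g vanishes on F. *)
Lemma rank_one_invariant x : E x ->
  BoundedOperator (rank_one_bounded_linear x gb) \in leaves_invariant L.
Proof.
move=> Ex; apply/asboolP => F LF y Fy /=.
have [EF|EF] := pselect (E `<=` F); last first.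
  rewrite (g0 LF EF Fy) scale0r.
  by have [[/set_mem]] := lattice_subspace LF.
have [[/set_mem F0 FL] _] := lattice_subspace LF.
have := FL (g y) x 0 (mem_set (EF _ Ex)) (mem_set F0).
by rewrite addr0 => /set_mem.
Qed.

(* The operator [x (x) g], with junk value [0] for [x] outside [E]. *)
Definition tens x : Alg L :=
  if pselect (E x) is left Ex then MkAlg (rank_one_invariant Ex) else 0.

Lemma tensE x y : E x -> tens x y = g y *: x.
Proof. by rewrite /tens; case: pselect. Qed.

Lemma algP (A B : Alg L) : (forall x, A x = B x) -> A = B.
Proof. by move=> AB; apply: val_inj; exact: bounded_operatorP. Qed.

Lemma algM (A B : Alg L) x : (A * B : Alg L) x = A (B x). Proof. by []. Qed.
Lemma algD (A B : Alg L) x : (A + B : Alg L) x = A x + B x. Proof. by []. Qed.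
Lemma algB (A B : Alg L) x : (A - B : Alg L) x = A x - B x. Proof. by []. Qed.
Lemma algZ k (A : Alg L) x : (k *: A : Alg L) x = k *: A x. Proof. by []. Qed.
Lemma alg0 x : (0 : Alg L) x = 0. Proof. by []. Qed.

Lemma tensP k x y : E x -> E y -> tens (k *: x + y) = k *: tens x + tens y.
Proof.
move=> Ex Ey; apply: algP => w; rewrite algD algZ !tensE//; last exact: EP.
by rewrite scalerDr !scalerA mulrC.
Qed.

Lemma mul_tens A x : E x -> A * tens x = tens (A x).
Proof.
move=> Ex; apply: algP => w; rewrite algM !tensE//; last exact: EA.
exact: linearZ.
Qed.

Lemma tens_idempotent x : E x -> g x = 1 -> tens x * tens x = tens x.
Proof. by move=> Ex gx; rewrite mul_tens// tensE// gx scale1r. Qed.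

Lemma tens_decompose x : E x ->
  exists2 u, E u /\ g u = 0 & x = g x *: z + u.
Proof.
move=> Ex; exists (x - g x *: z); last by rewrite addrC subrK.
split; first by rewrite addrC -scaleNr; exact: EP.
by rewrite raddfB/= linZ gz mulr1 subrr.
Qed.

(** * A map vanishing at 1 and at the idempotent z (x) g, on one member E *)

Section Centered.
Context (D : {additive Alg L -> 'B(X)}).
Hypotheses (DZ : forall k A, D (k *: A) = k *: D A) (DJ : jordan_at_zero v D).
Hypotheses (D1 : D 1 = 0) (Dz : D (tens z) = 0).
Let P := tens z.
Let PP : P * P = P. Proof. exact: tens_idempotent. Qed.
Let B2 := @op_2torsion_free K X.

(** u (x) g is the difference of the idempotents (z + u) (x) g and z (x) g. *)
Lemma jordan_rule_tens A u : E u -> g u = 0 -> jordan_rule v D A (tens u).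
Proof.
move=> Eu gu; have Ezu : E (z + u) by exact: ED.
have rule_zu : jordan_rule v D A (tens (z + u)).
  apply: jordan_rule_idempotent => //; apply: tens_idempotent => //.
  by rewrite raddfD/= gz gu addr0.
have rule_z : jordan_rule v D A (- P).
  apply: jordan_rule_sym; rewrite /jordan_rule.
  have := jordan_rule_idempotent B2 A DJ D1 PP => /jordan_rule_sym.
  rewrite /jordan_rule !raddfN/= !mulNr !mulrN => rP.
  by rewrite -opprD raddfN/= rP !opprD.
have -> : tens u = tens (z + u) - P.
  by have := tensP 1 Ez Eu; rewrite !scale1r => ->; rewrite addrC addKr.
by apply: jordan_rule_sym; apply: jordan_ruleDl; exact: jordan_rule_sym.
Qed.

(** The rule for N and P reads D N y = g(y) D N z + g(D N y) z. The last term, a trace of an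
    antiderivation, vanishes: at z by applying g, and on the kernel of g because N^2 = 0 gives g(D N
    y) u = 0. *)
Lemma tens_offdiag u : E u -> g u = 0 ->
  forall y, D (tens u) y = g y *: D (tens u) z.
Proof.
move=> Eu gu; set N := tens u.
have NP : N * P = N by rewrite /P mul_tens// tensE// gz scale1r.
have PN : P * N = 0.
  rewrite mul_tens// tensE// gu scale0r.
  by apply: algP => w; rewrite tensE// scaler0.
have NN : N * N = 0.
  rewrite mul_tens// tensE// gu scale0r.
  by apply: algP => w; rewrite tensE// scaler0.
have DN y : D N y = g y *: D N z + g (D N y) *: z.
  have := jordan_rule_idempotent0 B2 DJ D1 PP N Dz.
  rewrite /jordan_rule NP PN addr0 Dz mulr0 mul0r addr0 add0r.
  move=> /(congr1 (fun T : 'B(X) => T y)).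
  by rewrite opD !opM /v /= !tensE// linZ.
have gDNz : g (D N z) = 0.
  have /(congr1 g) := DN z; rewrite gz scale1r raddfD/= linZ gz mulr1.
  by move=> /esym/(canRL (addKr _)); rewrite addNr.
have DNker y : g y = 0 -> g (D N y) = 0.
  move=> gy; have := jordan_at_zero_eq0 DJ (a := N) (b := N).
  rewrite NN addr0 => /(_ erefl)/B2/(congr1 (fun T : 'B(X) => T y)).
  rewrite opD !opM /v /= !tensE// linZ gy scale0r add0r => /eqP.
  rewrite scaler_eq0 => /predU1P[//|/eqP u0].
  suff -> : N = 0 by rewrite raddf0 op0 raddf0.
  by apply: algP => w; rewrite tensE// u0 scaler0.
move=> y; rewrite DN; suff -> : g (D N y) = 0 by rewrite scale0r addr0.
have -> : y = g y *: z + (y - g y *: z) by rewrite addrC subrK.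
rewrite linearP/= linearP/= gDNz mulr0 add0r DNker//.
by rewrite raddfB/= linZ gz mulr1 subrr.
Qed.

(** P A P = g(A z) P is sent to 0, while the triple rule sends it to P (D A) P = g(D A z) P. *)
Lemma corner_eq0 A : g (D A z) = 0.
Proof.
have PAP : P * A * P = g (A z) *: P.
  apply: algP => w; rewrite !algM algZ !tensE//.
  by rewrite !linZ scalerA mulrC.
have := jordan_triple_idempotent0 B2 DJ D1 PP A Dz.
rewrite PAP DZ Dz scaler0 => /esym/(congr1 (fun T : 'B(X) => g (T z))).
rewrite !opM /v /= !tensE// gz scale1r linZ gz mulr1.
by rewrite raddf0.
Qed.

(* The operator [x (x) (g A - g (A z) g)], whose functional is [0] at [z]. *)
Let residual A x := tens x * A - g (A z) *: tens x.

Let residualE A x y : E x ->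
  residual A x y = (g (A y) - g (A z) * g y) *: x.
Proof. by move=> Ex; rewrite algB algM algZ !tensE// scalerA -scalerBl. Qed.

(** W maps into the line of z and kills z, so W P = 0, P W = W and W^2 = 0. The rule for W and P
    gives g(D W z) = 0; then W^2 = 0 makes every coefficient of W annihilate D W z, so either D W z
    = 0 or W = 0. *)
Lemma residual_z A : D (residual A z) z = 0.
Proof.
set W := residual A z.
have WE y : W y = (g (A y) - g (A z) * g y) *: z by exact: residualE.
clearbody W.
have Wz : W z = 0 by rewrite WE gz mulr1 subrr scale0r.
have WP : W * P = 0.
  by apply: algP => y; rewrite algM tensE// linZ Wz scaler0.
have PW : P * W = W.
  by apply: algP => y; rewrite algM tensE// WE linZ gz mulr1.
have WW : W * W = 0.
  by apply: algP => y; rewrite algM [in LHS](WE y) linZ Wz scaler0.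
have gDWz : g (D W z) = 0.
  have := jordan_rule_idempotent0 B2 DJ D1 PP W Dz.
  rewrite /jordan_rule WP PW add0r Dz mulr0 mul0r addr0 add0r.
  move=> /(congr1 (fun T : 'B(X) => g (T z))).
  rewrite opD !opM /v /= !tensE// gz scale1r raddfD/= linZ gz mulr1.
  by move=> /esym/(canRL (addKr _)); rewrite addNr.
have DWW y : (g (A y) - g (A z) * g y) *: D W z = 0.
  have := jordan_at_zero_eq0 DJ (a := W) (b := W).
  rewrite WW addr0 => /(_ erefl)/B2/(congr1 (fun T : 'B(X) => T y)).
  rewrite opD !opM /v /= WE [W (D W y)]WE linZ => DW0.
  have := congr1 g DW0; rewrite raddfD/= !linZ gDWz gz mulr0 mulr1 add0r raddf0.
  by move=> c0; move: DW0; rewrite c0 scale0r addr0.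
have [//|/eqP DWz] := eqVneq (D W z) 0.
suff -> : W = 0 by rewrite raddf0.
apply: algP => y; rewrite WE alg0; apply/eqP.
by have /eqP := DWW y; rewrite !scaler_eq0 => /predU1P[->|/eqP//]; rewrite eqxx.
Qed.

(** Here W P = P W = 0, so D W anticommutes with P and therefore (D W) P = 0. *)
Lemma residual_ker A u : E u -> g u = 0 -> D (residual A u) z = 0.
Proof.
move=> Eu gu; set W := residual A u.
have WE y : W y = (g (A y) - g (A z) * g y) *: u by exact: residualE.
clearbody W.
have WP : W * P = 0.
  apply: algP => y; rewrite algM tensE// linZ WE gz mulr1 subrr.
  by rewrite scale0r scaler0.
have PW : P * W = 0.
  by apply: algP => y; rewrite algM tensE// WE linZ gu mulr0 scale0r.
have := jordan_at_zero_eq0 DJ (a := W) (b := P).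
rewrite WP PW addr0 => /(_ erefl); rewrite Dz mulr0 mul0r addr0 add0r.
have vPP : v P * v P = v P by rewrite -rmorphM PP.
move=> /(anticommute_idempotent B2 vPP)[/(congr1 (fun T : 'B(X) => T z)) + _].
by rewrite opM /v /= tensE// gz scale1r.
Qed.

Lemma tens_implements A x : E x -> D A x = D (tens (A x)) z - A (D (tens x) z).
Proof.
(* The rule for A and y (x) g is evaluated at z. The terms D (tens y * A) z and D (tens y) (A z)
   both equal g(A z) D (tens y) z and cancel; the term g(D A z) y is zero by [corner_eq0]. *)
have key y : E y -> jordan_rule v D A (tens y) ->
    (forall w, D (tens y) w = g w *: D (tens y) z) -> D (residual A y) z = 0 ->
    D A y = D (tens (A y)) z - A (D (tens y) z).
  move=> Ey + offy; rewrite /residual raddfB/= DZ => + /subr0_eq res.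
  rewrite /jordan_rule raddfD/= mul_tens// => /(congr1 (fun T : 'B(X) => T z)).
  rewrite !opD !opM /v /= !tensE// res gz scale1r corner_eq0 scale0r addr0 opZ.
  by rewrite (offy (A z)) => /addIr ->; rewrite addrK.
have keyz : D A z = D (tens (A z)) z - A (D (tens z) z).
  apply: key => //; last exact: residual_z.
    exact: jordan_rule_idempotent.
  by move=> w; rewrite Dz op0 scaler0.
(* Both sides are linear in x, which is split along z and the kernel of g. *)
move=> /tens_decompose[u [Eu gu] ->]; move: (g x) => k.
have keyu : D A u = D (tens (A u)) z - A (D (tens u) z).
  apply: key => //; first exact: jordan_rule_tens.
    exact: tens_offdiag.
  exact: residual_ker.
have DP a b : D (k *: a + b) = k *: D a + D b by rewrite raddfD/= DZ.
rewrite !opP !tensP//; try exact: EA.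
rewrite !DP !opD !opZ opP keyz keyu.
by rewrite opprD scalerBr addrACA.
Qed.

Lemma derivation_on_member0 A B x : E x -> D (A * B) x = D A (B x) + A (D B x).
Proof.
move=> Ex; have EBx := EA B Ex; rewrite (tens_implements (A * B) Ex).
rewrite (tens_implements A EBx) (tens_implements B Ex) algM raddfB/=.
by rewrite addrA subrK.
Qed.

End Centered.

Lemma derivation_on_member (D : {additive Alg L -> 'B(X)}) :
    (forall k A, D (k *: A) = k *: D A) -> jordan_at_zero v D -> D 1 = 0 ->
  forall A B x, E x -> D (A * B) x = D A (B x) + A (D B x).
Proof.
move=> DZ DJ D1 A B x Ex; have PP := tens_idempotent Ez gz.
(* This commutator implements [D] at z (x) g, so [D'] vanishes there. *)
pose t := D (tens z) * v (tens z) - v (tens z) * D (tens z).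
pose D' := D \- inner_derivation v t.
have innerZ (s : 'B(X)) k C :
    inner_derivation v s (k *: C) = k *: inner_derivation v s C.
  have vZ : v (k *: C) = k *: v C by [].
  apply: bounded_operatorP => y.
  by rewrite /inner_derivation vZ opZ !opB !opM !opZ opZr scalerBr.
have D'Z k C : D' (k *: C) = k *: D' C.
  by rewrite /D' /= DZ innerZ [RHS]scalerBr.
have D'1 : D' 1 = 0.
  by rewrite /D' /= D1 /inner_derivation rmorph1 mulr1 mul1r subrr subr0.
have D'z : D' (tens z) = 0.
  by rewrite /D' /= (inner_derivation_idempotent (@op_2torsion_free K X))// subrr.
have D'E C y : D' C y = D C y - inner_derivation v t C y by [].
have := derivation_on_member0 D'Z (jordan_at_zeroB_inner t DJ) D'1 D'z A B Ex.
rewrite !D'E inner_derivationM opD !opM opBr => /eqP.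
by rewrite subr_eq => /eqP ->; rewrite addrACA !subrK.
Qed.

(** Commutation with the idempotent x (x) g, where g(x) = 1, evaluated at z, gives c x = g(c z) x. A
    vector u in the kernel of g is reached as (z + u) - z. *)
Lemma commute_on_member (c : 'B(X)) :
    (forall e : Alg L, e * e = e -> v e * c = c * v e) ->
  forall x, E x -> c x = g (c z) *: x.
Proof.
move=> ce; have c1 x : E x -> g x = 1 -> c x = g (c z) *: x.
  move=> Ex gx; have := ce _ (tens_idempotent Ex gx).
  move=> /(congr1 (fun T : 'B(X) => T z)).
  by rewrite !opM /v /= !tensE// gz scale1r.
move=> x /tens_decompose[u [Eu gu] ->]; move: (g x) => k.
rewrite opP scalerDr [in LHS](c1 z)//; congr (_ + _).
  by rewrite !scalerA mulrC.
have := c1 (z + u); rewrite raddfD/= gz gu addr0 => /(_ (ED Ez Eu) erefl).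
by rewrite opDr scalerDr [in LHS](c1 z)// => /addrI.
Qed.

End Local.

(** * From the members of P_L to the whole space *)

Section Global.
Context (R : realType) (K : numFieldType) (hK : scalar_field R K).
Context (X : normedModType K) (L : subspace_lattice X).

(** z is taken in E outside E_-; the functional separating it from E_- vanishes on each F not
    containing E, as F lies in E_-. *)
Lemma PL_functional E : PL L E -> exists (g : {scalar X}) (z : X),
  [/\ bounded_functional g, E z, g z = 1 &
      forall F x, members L F -> ~ E `<=` F -> F x -> g x = 0].
Proof.
move=> [LE /existsNP[z /not_implyP[Ez lz]]].
have lower_sub : Defs.subspace (lower L E).
  by apply: (@lattice_subspace _ _ L); apply: (@lattice_join _ _ L) => F /= [].
have [g [gb g0 gz]] := separating_functional hK lower_sub lz.
exists g, z; split=> // F x LF EF Fx; apply: g0.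
apply: (@subset_closure _ (linear_span _)); apply: sub_gen_smallest.
by exists F.
Qed.

Hypothesis hL : join (PL L) = setT.
Context (delta : {linear Alg L -> 'B(X)}).
Let v : {rmorphism Alg L -> 'B(X)} := val.

Lemma Jordan_derivable_at_zeroE :
  Jordan_derivable_at_zero delta <-> jordan_at_zero v delta.
Proof. by split=> J A B /J; rewrite /jordan_rule addrA. Qed.

(** On each E the operator [delta 1] is one scalar, and A maps E into E, so the commutator vanishes
    on E. *)
Lemma jordan_at_zero_commutant :
  jordan_at_zero v delta -> Alg_commutant L (delta 1).
Proof.
move=> J A; apply: subr0_eq; apply: (eq0_on_join hL) => E PE x Ex.
have [g [z [gb Ez gz g0]]] := PL_functional PE; have [LE _] := PE.
have cE := commute_on_member LE gb Ez gz g0 (fun e => jordan_at_zero_commute1 J (e := e)).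
have EAx : E (A x).
  by case: A => A /= /asboolP AL; exact: AL.
by rewrite opB !opM (cE (A x))// (cE x)// opZr subrr.
Qed.

Lemma jordan_at_zero_derivation (D : {additive Alg L -> 'B(X)}) :
    (forall k A, D (k *: A) = k *: D A) -> jordan_at_zero v D -> D 1 = 0 ->
  derivation D.
Proof.
move=> DZ DJ D1 A B; apply: subr0_eq; apply: (eq0_on_join hL) => E PE x Ex.
have [g [z [gb Ez gz g0]]] := PL_functional PE; have [LE _] := PE.
rewrite opB opD !opM.
by rewrite (derivation_on_member LE gb Ez gz g0 DZ DJ D1)// subrr.
Qed.

Let c := delta 1.
Let D := delta \- (c \*o v).

(** In D A B + A D B the term - A c B is the correction of a generalized derivation, and - c A B is
    D (A B) - delta (A B). *)
Lemma generalized_derivationE : generalized_derivation delta <-> derivation D.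
Proof.
have E A B : D A * v B + v A * D B =
    delta A * v B + v A * delta B - v A * c * v B - c * v (A * B).
  have DE C : D C = delta C - c * v C by [].
  by rewrite !DE mulrBl mulrBr rmorphM !mulrA addrAC addrA.
split=> der A B.
  rewrite [RHS]E; rewrite -[LHS]/(delta (A * B) - c * v (A * B)); congr (_ - _).
  exact: der.
have := der A B; rewrite [RHS]E -[LHS]/(delta (A * B) - c * v (A * B)).
by move=> /addIr.
Qed.

Lemma derivation_jordan_at_zero (d : {additive Alg L -> 'B(X)}) :
  derivation d -> jordan_at_zero v d.
Proof. by move=> der A B _; rewrite /jordan_rule raddfD/= !der. Qed.

(** Once c is moved to the left, the four terms add up to 2 c (A B + B A) = 0. *)
Lemma jordan_at_zero_mul1 : Alg_commutant L c -> jordan_at_zero v (c \*o v).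
Proof.
move=> cv A B AB.
have cAB C1 C2 : v C1 * (c * v C2) = c * v C1 * v C2 by rewrite mulrA -[v C1 * c]cv.
have fE C : (c \*o v : {additive Alg L -> 'B(X)}) C = c * v C by [].
rewrite /jordan_rule AB raddf0 !fE !cAB -!mulrA -!rmorphM addrACA -!mulrDr -!rmorphD AB.
by rewrite addr0 rmorph0 mulr0.
Qed.

Lemma Jordan_derivable_at_zero_iff :
  Jordan_derivable_at_zero delta <->
  generalized_derivation delta /\ Alg_commutant L c.
Proof.
rewrite Jordan_derivable_at_zeroE; split=> [dJ|[/generalized_derivationE Dder cv]].
  have cv := jordan_at_zero_commutant dJ; split=> //.
  apply/generalized_derivationE/jordan_at_zero_derivation.
  - move=> k A; have -> : (k *: D A) = k *: delta A - k *: (c * v A) by exact: scalerBr.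
    rewrite -[LHS]/(delta (k *: A) - c * v (k *: A)) linearZ_LR.
    congr (_ - _); apply: bounded_operatorP => x.
    by rewrite opZ !opM -opZr.
  - move=> A B AB; apply: jordan_ruleB; [exact: dJ | exact: jordan_at_zero_mul1].
  - by rewrite -[LHS]/(c - c * v 1) rmorph1 mulr1 subrr.
move=> A B AB.
have := jordan_ruleD (derivation_jordan_at_zero Dder AB) (jordan_at_zero_mul1 cv AB).
by rewrite /jordan_rule /D /= !subrK.
Qed.

End Global.

Theorem theorem2p4 (R : realType) (K : numFieldType) (hK : scalar_field R K)
    (X : completeNormedModType K) (L : subspace_lattice X)
    (hL : join (PL L) = setT) (delta : {linear Alg L -> 'B(X)}) :
  (Jordan_derivable_at_zero delta <->
     generalized_derivation delta /\ Alg_commutant L (delta 1)) /\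
  (delta 1 = 0 -> (Jordan_derivable_at_zero delta <-> derivation delta)).
Proof.
have main := Jordan_derivable_at_zero_iff hK hL delta.
split=> // d1; rewrite main /generalized_derivation d1; split=> [[der _] A B|der].
  by rewrite der mulr0 mul0r subr0.
split=> [A B|A]; first by rewrite der mulr0 mul0r subr0.
by rewrite mul0r mulr0.
Qed.
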